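(* Let $\mathcal{A}\subset\mathbb{R}^d$ be a set of $n$ points in general position whose coefficients (coordinates) have bit-size bounded by $\tau$, where $n\gg d$ and $\tau\gg d$, and let a triangulation of $\mathcal{A}$ with $t$ cells be given, computed by an incremental convex hull algorithm like the Beneath-and-Beyond algorithm with dynamic determinants described in the context (so that the adjoint and the determinant of the orientation matrix of every cell have been precomputed). Then the orientation predicates involved in point location algorithms that perform orientation tests with respect to the facets of the triangulation can be computed in $O(d)$ arithmetic operations, using $O(d^2t)$ numbers of maximum bit-size $O(d\tau)$ as space.
   Context: General position: every $d+1$ points of $\mathcal{A}$ are affinely independent. A cell is a $d$-simplex spanned by $d+1$ points of $\mathcal{A}$; a triangulation of a point set is a collection of such simplices whose union is the convex hull of the set and any two of which intersect in a common face or not at all. A facet of the triangulation is a $(d-1)$-face of a cell; cells and facets are identified with their vertex sets. For an (ordered) set $C=\{c_1,\dots,c_{d+1}\}\subset\mathbb{R}^d$, the orientation matrix $A_C$ is the $(d+1)\times(d+1)$ matrix whose $i$-th column is the homogeneous vector $(c_i,1)$; $A_C^{\mathrm{adj}}=\det(A_C)A_C^{-1}$ denotes its adjoint (adjugate) matrix. The orientation predicate on $C$ is the sign of $\det(A_C)$; the orientation test of a query point $q\in\mathbb{R}^d$ with respect to a facet $F$ is the orientation predicate on $F\cup\{q\}$. The $O(d)$ bound is per predicate. The notation $n\gg d$, $\tau\gg d$ means that $n$ and $\tau$ are assumed to be large compared with $d$. Beneath-and-Beyond algorithm with dynamic determinants: sort the points in increasing lexicographic order as $a_1,\dots,a_n$.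 Start with the cell $\{a_1,\dots,a_{d+1}\}$, and insert $a_{d+2},\dots,a_n$ one by one; when $a$ is inserted, for each boundary facet $F$ of the current triangulation, with $C=F\cup\{u\}$ the unique cell containing it, test whether $\det(A_C)\det(A_{C'})<0$, where $C'=F\cup\{a\}$ and $A_{C'}$ is $A_C$ with the column of $u$ replaced by that of $a$; if so, add the cell $C'$ to the triangulation. For every cell $C$ of the triangulation, $\det(A_C)$ and $A_C^{\mathrm{adj}}$ are computed (by updating those of a neighbouring cell after the one-column change) and stored. The final collection of cells is the triangulation of $\mathcal{A}$. *)

(* Defs.v *)
From HB Require Import structures.
From mathcomp Require Import all_boot all_order all_algebra finmap.
From mathcomp Require Import reals.

Set Implicit Arguments.
Unset Strict Implicit.
Unset Printing Implicit Defensive.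

Import Order.TTheory GRing.Theory Num.Theory.
Local Open Scope ring_scope.
Local Open Scope fset_scope.

(* Number of binary digits of |z|, that is, the least b with |z| < 2 ^ b. *)
Definition bitsize (z : int) : nat := up_log 2 (absz z).+1.

(* Bit-size is a notion about integers: the bound includes integrality. *)
Definition bitsize_le (R : realFieldType) (b : nat) (x : R) : Prop :=
  exists2 z : int, x = z%:~R & (bitsize z <= b)%N.

Definition affinely_independent (R : realFieldType) (d m : nat)
    (p : 'I_m -> 'cV[R]_d) : Prop :=
  forall l : 'I_m -> R,
    \sum_(i < m) l i = 0 -> \sum_(i < m) l i *: p i = 0 -> forall i, l i = 0.

Definition general_position (R : realFieldType) (d : nat)
    (A : {fset 'cV[R]_d}) : Prop :=
  forall p : 'I_(d + 1) -> 'cV[R]_d,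
    injective p -> (forall i, p i \in A) -> affinely_independent p.

Definition homog (R : realFieldType) (d : nat) (x : 'cV[R]_d) : 'cV[R]_(d + 1) :=
  col_mx x (const_mx 1).

Definition orientation_mx (R : realFieldType) (d : nat)
    (c : 'I_(d + 1) -> 'cV[R]_d) : 'M[R]_(d + 1) :=
  \matrix_(k, j) homog (c j) k 0.

Definition orientation (R : realFieldType) (d : nat)
    (c : 'I_(d + 1) -> 'cV[R]_d) : R :=
  Num.sg (\det (orientation_mx c)).

Definition coords (R : realFieldType) (d : nat) (x : 'cV[R]_d) : seq R :=
  [seq x i 0 | i <- enum 'I_d].

Definition lex_le (R : realFieldType) (d : nat) : rel 'cV[R]_d :=
  fun x y => ((coords x : seqlexi R) <= (coords y : seqlexi R))%O.

(* The points of A in increasing lexicographic order.  Indices start at 0;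
   from here on a vertex is named by its index in this order. *)
Definition point (R : realFieldType) (d : nat) (A : {fset 'cV[R]_d}) (k : nat) :
    'cV[R]_d :=
  nth 0 (sort (@lex_le R d) A) k.

(* An ordered cell; the order of the vertices is that of the columns of its
   orientation matrix. *)
Notation cell d := {ffun 'I_(d + 1) -> nat}.

Definition vertices (d : nat) (C : cell d) : {fset nat} :=
  [fset C j | j in 'I_(d + 1)].

Definition facet_opp (d : nat) (C : cell d) (i : 'I_(d + 1)) : {fset nat} :=
  vertices C `\ C i.

Definition is_facet (d : nat) (T : seq (cell d)) (F : {fset nat}) : Prop :=
  exists2 C, C \in T & exists i, F = facet_opp C i.

(* A facet is on the boundary when exactly one cell contains it. *)
Definition boundary (d : nat) (T : seq (cell d)) (F : {fset nat}) : bool :=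
  count (fun C : cell d => F `<=` vertices C) T == 1%N.

Definition ncells (d : nat) (T : seq (cell d)) : nat :=
  #|` [fset vertices C | C in T] |.

Record cell_data (R : realFieldType) (d : nat) := CellData {
  cverts : cell d;
  cdet : R;
  cadj : 'M[R]_(d + 1)
}.

Definition cells (R : realFieldType) (d : nat) (s : seq (cell_data R d)) :
    seq (cell d) :=
  [seq cverts C | C <- s].

(* Dynamic determinant and adjugate: if D and B are the determinant and the
   adjugate of a matrix, these are the ones of the matrix obtained by adding
   the vector w to its column i (matrix determinant lemma and
   Sherman-Morrison formula, both multiplied out by D). *)
Definition dyn_det (R : realFieldType) (m : nat) (D : R) (B : 'M[R]_m)
    (i : 'I_m) (w : 'cV[R]_m) : R :=
  D + (B *m w) i 0.

Definition dyn_adj (R : realFieldType) (m : nat) (D : R) (B : 'M[R]_m)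
    (i : 'I_m) (w : 'cV[R]_m) : 'M[R]_m :=
  D^-1 *: (dyn_det D B i w *: B - (B *m w) *m row i B).

(* The data of the cell C' obtained from C by replacing its i-th vertex with
   the k-th point, computed from the data stored for C. *)
Definition attach (R : realFieldType) (d : nat) (A : {fset 'cV[R]_d}) (k : nat)
    (C : cell_data R d) (i : 'I_(d + 1)) : cell_data R d :=
  let w := homog (point A k) - homog (point A (cverts C i)) in
  CellData [ffun j => if j == i then k else cverts C j]
           (dyn_det (cdet C) (cadj C) i w)
           (dyn_adj (cdet C) (cadj C) i w).

Definition insert_point (R : realFieldType) (d : nat) (A : {fset 'cV[R]_d})
    (s : seq (cell_data R d)) (k : nat) : seq (cell_data R d) :=
  s ++ [seq attach A k Ci.1 Ci.2 |
         Ci <- [seq (C, i) | C <- s, i <- enum 'I_(d + 1)]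
         & boundary (cells s) (facet_opp (cverts Ci.1) Ci.2)
           && (cdet Ci.1 * cdet (attach A k Ci.1 Ci.2) < 0)].

Definition initial_cell (R : realFieldType) (d : nat) (A : {fset 'cV[R]_d}) :
    cell_data R d :=
  let M := orientation_mx (fun j : 'I_(d + 1) => point A j) in
  CellData [ffun j : 'I_(d + 1) => val j] (\det M) (\adj M).

Definition beneath_beyond (R : realFieldType) (d : nat) (A : {fset 'cV[R]_d}) :
    seq (cell_data R d) :=
  foldl (insert_point A) [:: initial_cell A] (iota (d + 1) (#|` A| - (d + 1))).

(* The numbers kept by the algorithm: for each cell, the determinant and then
   the entries of the adjugate matrix, row by row. *)
Definition stored (R : realFieldType) (d : nat) (s : seq (cell_data R d)) :
    seq R :=
  flatten [seq cdet C :: [seq cadj C i j | i <- enum 'I_(d + 1),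
                                           j <- enum 'I_(d + 1)] | C <- s].

(* Straight-line programs.  An instruction performs one arithmetic operation
   on two memory cells given by their addresses and writes the result to a new
   memory cell, so the number of operations is the length of the program.
   There are no constants, and a program sees numbers only through the memory;
   reading beyond the end of the memory yields 0.  Leaving out division only
   restricts the programs. *)
Inductive arith_op := OpAdd | OpSub | OpMul.

Definition instr : Type := (arith_op * nat * nat)%type.

Definition eval_op (R : realFieldType) (o : arith_op) (x y : R) : R :=
  match o with OpAdd => x + y | OpSub => x - y | OpMul => x * y end.

Definition step (R : realFieldType) (mem : seq R) (c : instr) : seq R :=
  let: (o, x, y) := c in rcons mem (eval_op o mem`_x mem`_y).

Definition exec (R : realFieldType) (mem : seq R) (p : seq instr) : seq R :=
  foldl (@step R) mem p.

Definition output (R : realFieldType) (mem : seq R) : R := last 0 mem.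

(* An ordering g of F together with a query point, the latter being None. *)
Definition orders (d : nat) (F : {fset nat})
    (g : {ffun 'I_(d + 1) -> option nat}) : Prop :=
  [fset g j | j in 'I_(d + 1)] = None |` [fset Some v | v in F].

(* The orientation test of q with respect to F, for the ordering g. *)
Definition orientation_test (R : realFieldType) (d : nat) (A : {fset 'cV[R]_d})
    (g : {ffun 'I_(d + 1) -> option nat}) (q : 'cV[R]_d) : R :=
  orientation (fun j => if g j is Some v then point A v else q).

(* Main.v *)
(* Replacing column i of an orientation matrix A by a vector v turns its
   determinant into (\adj A *m v) i 0, which is linear in v.  Hence the updates of
   the dynamic algorithm are exact (general position makes every determinant
   nonzero), and the orientation of a query point with respect to a facet
   opposite to vertex i of a stored cell is, up to the sign of a permutation,
   the dot product of row i of the stored adjugate with (q, 1): d products and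
   d additions.  Leibniz' formula bounds determinants and minors by
   (d+1)! 2^(tau (d+1)) <= 2^(3 d tau) once d <= tau.  Finally every inserted
   cell consists of the new point and a facet lying in exactly one older cell,
   so no two entries of the list of cells have the same vertices. *)
Require Import Defs.
From mathcomp Require Import all_boot all_order all_algebra finmap.
From mathcomp Require Import reals.
From mathcomp Require Import fingroup perm zify.

Set Implicit Arguments.
Unset Strict Implicit.
Unset Printing Implicit Defensive.

Import Order.TTheory GRing.Theory Num.Theory.
Local Open Scope ring_scope.

(** * Determinant and adjugate after a change of one column *)

Section RankOneUpdate.

(** Laplace expansion along column [i]: its cofactors do not see that column, so they are those of
    [A]. *)
Lemma det_eq_off_col (R : comPzRingType) (m : nat) (A A' : 'M[R]_m) (i : 'I_m) :
  (forall k j, j != i -> A' k j = A k j) -> \det A' = (\adj A *m col i A') i 0.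
Proof.
move=> eqA; rewrite (expand_det_col _ i) !mxE; apply: eq_bigr => k _.
rewrite !mxE mulrC; congr (_ * _); rewrite /cofactor; congr (_ * \det _).
by apply/matrixP => a b; rewrite !mxE eqA // eq_sym neq_lift.
Qed.

Variables (R : realFieldType) (m : nat) (A A' : 'M[R]_m) (i : 'I_m).
Hypothesis eqA : forall k j, j != i -> A' k j = A k j.
Let w := col i A' - col i A.

Lemma dyn_detE : dyn_det (\det A) (\adj A) i w = \det A'.
Proof.
rewrite (det_eq_off_col eqA) (det_eq_off_col (A := A) (A' := A) (i := i)) //.
by rewrite /dyn_det /w mulmxBr [X in _ + X]mxE [X in _ + (_ + X)]mxE addrC subrK.
Qed.

(** Both sides are compared after left multiplication by the invertible [A'], which turns the right
    side into [\det A'] times the identity. *)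
Lemma dyn_adjE : \det A != 0 -> \det A' != 0 ->
  dyn_adj (\det A) (\adj A) i w = \adj A'.
Proof.
move=> D0 D'0; have uA' : A' \in unitmx by rewrite unitmxE unitfE.
apply: (can_inj (mulKmx uA')); rewrite mul_mx_adj.
have eA' : A' = A + w *m delta_mx 0 i.
  apply/matrixP => k j; rewrite !mxE big_ord1 !mxE eqxx /=.
  by have [->|/eqA ->] := eqVneq j i; rewrite ?mulr1 ?mulr0 ?addr0 // addrC subrK.
have rowE' : row i (\adj A) = delta_mx 0 i *m \adj A by rewrite rowE.
have sc : delta_mx 0 i *m (\adj A *m w) = ((\adj A *m w) i 0)%:M :> 'M_1.
  by rewrite -rowE; apply/matrixP => a b; rewrite !ord1 !mxE eqxx mulr1n.
rewrite /dyn_adj dyn_detE -scalemxAr mulmxBr -scalemxAr mulmxA rowE'.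
(* [A *m \adj A] contributes [\det A] and the rank-one term contributes the scalar
   [(\adj A *m w) i 0]; by [dyn_detE] they add up to [\det A']. *)
have -> : A' *m (\adj A *m w) = \det A' *: w.
  rewrite {1}eA' mulmxDl mulmxA mul_mx_adj -mulmxA sc mul_scalar_mx mul_mx_scalar.
  by rewrite -scalerDl -dyn_detE.
rewrite -scalemxAl -scalerBr {2}eA' mulmxDl mul_mx_adj mulmxA addrK.
by rewrite scale_scalar_mx -mul_scalar_mx -scalar_mxM mulrCA mulVf ?mulr1.
Qed.

End RankOneUpdate.

(** * Magnitude bounds for integers, determinants and adjugates *)

Section IntBounds.
Variable R : realFieldType.

(** Bounds on absolute values add under sums and multiply under products, so bit-sizes are converted
    only at the two ends of an estimate. *)
Definition int_bounded (M : nat) (x : R) : Prop :=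
  exists2 z : int, x = z%:~R & (absz z <= M)%N.

Lemma bitsize_int_bounded b (x : R) : bitsize_le b x -> int_bounded (2 ^ b) x.
Proof.
case=> z -> zb; exists z => //; rewrite (leq_trans (leqnSn _)) //.
by rewrite (leq_trans (up_logP _ (isT : 1 < 2)%N)) // leq_pexp2l.
Qed.

(** The extra bit is for the extreme value [2 ^ b], which has [b + 1] digits. *)
Lemma int_bounded_bitsize b x : int_bounded (2 ^ b) x -> bitsize_le b.+1 x.
Proof.
case=> z -> zb; exists z => //; apply: up_log_min => //.
by rewrite expnS mul2n -addnn -addn1 leq_add // expn_gt0.
Qed.

Lemma leq_bitsize_le b b' (x : R) : (b <= b')%N -> bitsize_le b x -> bitsize_le b' x.
Proof. by move=> bb' [z -> zb]; exists z => //; apply: leq_trans bb'. Qed.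

Lemma leq_int_bounded M M' x : (M <= M')%N -> int_bounded M x -> int_bounded M' x.
Proof. by move=> MM' [z -> zM]; exists z => //; apply: leq_trans MM'. Qed.

Lemma int_bounded1 : int_bounded 1 1.
Proof. by exists 1. Qed.

Lemma int_boundedD M N x y :
  int_bounded M x -> int_bounded N y -> int_bounded (M + N) (x + y).
Proof.
move=> [z -> zM] [u -> uN]; exists (z + u); first by rewrite intrD.
by lia.
Qed.

Lemma int_boundedM M N x y :
  int_bounded M x -> int_bounded N y -> int_bounded (M * N) (x * y).
Proof.
move=> [z -> zM] [u -> uN]; exists (z * u); first by rewrite intrM.
by rewrite abszM leq_mul.
Qed.

Lemma int_bounded_sign M (e : nat) x :
  int_bounded M x -> int_bounded M ((-1) ^+ e * x).
Proof.
move=> [z -> zM]; exists ((-1) ^+ e * z); last by rewrite abszMsign.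
by rewrite intrM rmorphXn rmorphN1.
Qed.

Lemma int_bounded_sum (I : finType) M (F : I -> R) :
  (forall i, int_bounded M (F i)) -> int_bounded (#|I| * M) (\sum_i F i).
Proof.
move=> bF; rewrite -sum_nat_const.
by apply: (big_ind2 int_bounded) => //; [exists 0 | move=> *; apply: int_boundedD].
Qed.

Lemma int_bounded_det n M (A : 'M[R]_n) :
  (forall i j, int_bounded M (A i j)) -> int_bounded (n`! * M ^ n) (\det A).
Proof.
move=> bA; rewrite -card_Sn; apply: int_bounded_sum => s.
apply: int_bounded_sign; rewrite -[X in (_ ^ X)%N]card_ord -prod_nat_const.
by apply: (big_ind2 int_bounded) => //;
  [exact: int_bounded1 | move=> *; apply: int_boundedM].
Qed.

Lemma int_bounded_adj n M (A : 'M[R]_n) :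
  (forall i j, int_bounded M (A i j)) ->
  forall i j, int_bounded (n.-1`! * M ^ n.-1) (\adj A i j).
Proof.
move=> bA i j; rewrite mxE; apply: int_bounded_sign.
by apply: int_bounded_det => a b; rewrite !mxE.
Qed.

End IntBounds.

Lemma fact_leq_exp2 n : (n.+1`! <= 2 ^ (n * n))%N.
Proof.
elim: n => // n IHn; rewrite factS (leq_trans (leq_mul (ltn_expl n.+1 (isT : 1 < 2)%N) IHn)) //.
by rewrite -expnD leq_pexp2l //; lia.
Qed.

(** * A straight-line program for a signed dot product *)

Section SignedDot.
Variable R : realFieldType.

Definition add_op (b : bool) : arith_op := if b then OpSub else OpAdd.

Lemma eval_add_op b (x y : R) : eval_op (add_op b) x y = x + (-1) ^+ b * y.
Proof. by case: b; rewrite ?expr0 ?expr1 ?mul1r ?mulN1r. Qed.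

(* [m] is the size of the memory before the run, so that the first instruction
   reads 0 at address [m]. *)
Fixpoint sdot_prog (b : bool) (m c : nat) (x y : nat -> nat) (k : nat) :
    seq instr :=
  if k is k'.+1 then
    sdot_prog b m c x y k' ++
      [:: (OpMul, x k', y k'); (add_op b, m + k'.*2, m + k'.*2.+1)]%N
  else [:: (add_op b, m, c)].

Lemma size_sdot_prog b m c x y k : size (sdot_prog b m c x y k) = k.*2.+1.
Proof. by elim: k => //= k IHk; rewrite size_cat IHk addn2. Qed.

Definition sdot (b : bool) (u : R) (p : nat -> R) (k : nat) : R :=
  (-1) ^+ b * (u + \sum_(j < k) p j).

(** All values written are recorded, not only the result, because the bit-size bound covers every
    number in memory. *)
Fixpoint sdot_trace (b : bool) (u : R) (p : nat -> R) (k : nat) : seq R :=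
  if k is k'.+1 then sdot_trace b u p k' ++ [:: p k'; sdot b u p k'.+1]
  else [:: sdot b u p 0].

Lemma size_sdot_trace b u p k : size (sdot_trace b u p k) = k.*2.+1.
Proof. by elim: k => //= k IHk; rewrite size_cat IHk addn2. Qed.

Lemma last_sdot_trace b u p k : last 0 (sdot_trace b u p k) = sdot b u p k.
Proof. by case: k => //= k; rewrite last_cat. Qed.

Lemma exec_sdot b mem c x y k :
  (c < size mem)%N ->
  (forall j, j < k -> x j < size mem)%N -> (forall j, j < k -> y j < size mem)%N ->
  exec mem (sdot_prog b (size mem) c x y k) =
  mem ++ sdot_trace b mem`_c (fun j => mem`_(x j) * mem`_(y j)) k.
Proof.
set p := fun j => _ => cm; elim: k => [|k IHk] xm ym.
  (* Address [size mem] lies just past the end and reads 0, so the first instruction yields the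
     signed initial term. *)
  rewrite /= -cats1 eval_add_op (nth_default 0 (leqnn _)) /sdot.
  by rewrite big_ord0 add0r addr0.
rewrite /exec /= foldl_cat -/(exec mem _) IHk; try by move=> j /ltnW; auto.
have lt_nth j : (j < size mem)%N ->
    (mem ++ sdot_trace b mem`_c p k)`_j = mem`_j.
  by move=> jm; rewrite nth_cat jm.
rewrite /= !lt_nth ?xm ?ym // -/(p k) -[LHS]cats1 -[X in X ++ _]cats1 -!catA.
congr (mem ++ (_ ++ [:: _; _])).
rewrite !nth_rcons !size_cat size_sdot_trace eqxx ltnn addnS ltnSn.
rewrite nth_cat ltnNge leq_addr addKn /=.
(* Offset [k.*2] is the last entry of the trace so far, that is, the previous partial sum. *)
rewrite -[X in nth _ _ X]/(k.*2.+1.-1) -(size_sdot_trace b mem`_c p).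
rewrite nth_last last_sdot_trace eval_add_op /sdot big_ord_recr /= addrA.
by rewrite [RHS]mulrDr.
Qed.

Lemma int_bounded_sdot_trace b u p k M :
  int_bounded M u -> (forall j, j < k -> int_bounded M (p j))%N ->
  forall v, v \in sdot_trace b u p k -> int_bounded (k.+1 * M) v.
Proof.
move=> bu; elim: k => [|k IHk] bp v /=.
  rewrite inE => /eqP ->; rewrite /sdot big_ord0 addr0 mul1n.
  exact: int_bounded_sign.
rewrite mem_cat => /orP[/IHk vM|]; first by
  apply: (@leq_int_bounded _ (k.+1 * M)); [rewrite leq_mul | apply: vM => j /ltnW; auto].
rewrite !inE => /orP[] /eqP ->.
  by apply: (@leq_int_bounded _ M); [rewrite leq_pmull | apply: bp].
apply: int_bounded_sign; rewrite mulSn; apply: int_boundedD => //.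
rewrite -[X in int_bounded (X * _)]card_ord; apply: int_bounded_sum => j; exact: bp.
Qed.

End SignedDot.

(** * Combinatorics of cells under insertion *)

Section Cells.
Variable d : nat.
Implicit Types (C : cell d) (T : seq (cell d)) (i : 'I_(d + 1)).

Definition replace_vertex (k : nat) C i : cell d :=
  [ffun j => if j == i then k else C j].

Lemma verticesP C v : reflect (exists j, v = C j) (v \in vertices C).
Proof.
by apply: (iffP (imfsetP _ _ _ _)) => [[j _ ->] | [j ->]]; exists j.
Qed.

Lemma vertices_replace k C i : injective C ->
  vertices (replace_vertex k C i) = (k |` facet_opp C i)%fset.
Proof.
move=> injC; apply/fsetP => v; rewrite !in_fsetE; apply/verticesP/idP.
  case=> j ->; rewrite ffunE; have [ji|ji] := eqVneq j i; first by rewrite eqxx.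
  by apply/orP; right; rewrite (inj_eq injC) ji; apply/verticesP; exists j.
case/orP => [/eqP ->|]; first by exists i; rewrite ffunE eqxx.
case/andP => vi /verticesP[j vE]; exists j; rewrite ffunE.
by have [ji|//] := eqVneq j i; rewrite vE ji eqxx in vi.
Qed.

Lemma facet_opp_inj C : injective C -> injective (facet_opp C).
Proof.
move=> injC i j eqF; apply/eqP/negPn/negP => ij.
have : C j \in facet_opp C i; last by rewrite eqF !in_fsetE eqxx.
rewrite !in_fsetE (inj_eq injC) eq_sym ij /=.
by apply/verticesP; exists j.
Qed.

Lemma count1_inj (I : eqType) (P : pred I) (s : seq I) x y :
  count P s == 1%N -> x \in s -> y \in s -> P x -> P y -> x = y.
Proof.
rewrite -size_filter => sz xs ys Px Py.
have: x \in filter P s by rewrite mem_filter Px.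
have: y \in filter P s by rewrite mem_filter Py.
by case: (filter P s) sz => [|z []] //= _; rewrite !inE => /eqP -> /eqP ->.
Qed.

(** The insertion invariant. Indices below [k] make point [k] a new vertex, and distinct vertex sets
    make [ncells] the length of the list. *)
Definition proper_cells (k : nat) T : Prop :=
  [/\ T != [::], forall C, C \in T -> injective C /\ (forall j, C j < k)%N
    & uniq (map (@vertices d) T)].

(** New cells contain [k], hence differ from old ones. Deleting [k] from a new cell recovers its
    facet, the boundary condition recovers the only old cell containing that facet, and the facet
    then determines the opposite index. *)
Lemma proper_cells_insert k T (Q : pred (cell d * 'I_(d + 1))) :
  (forall p, Q p -> boundary T (facet_opp p.1 p.2)) -> proper_cells k T ->
  proper_cells k.+1
    (T ++ [seq replace_vertex k p.1 p.2 |
            p <- [seq (C, i) | C <- T, i <- enum 'I_(d + 1)] & Q p]).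
Proof.
move=> bQ [T0 properT uniqT]; split=> [|C|].
- by case: (T) T0.
- rewrite mem_cat => /orP[/properT[injC ltC]|]; first by split=> // j; apply: leqW.
  case/mapP => -[B i]; rewrite mem_filter => /andP[_ /allpairsP[[B' i'] []]] /=.
  move=> /properT[injB ltB] _ [-> ->] ->; split=> [j1 j2|j]; rewrite !ffunE.
    case: eqP => [->|_]; case: eqP => [->|_] //; last exact: injB.
      by move=> kE; have := ltB j2; rewrite -kE ltnn.
    by move=> kE; have := ltB j1; rewrite kE ltnn.
  by case: eqP => // _; apply: leqW.
have inL p : p \in [seq (C, i) | C <- T, i <- enum 'I_(d + 1)] -> p.1 \in T.
  by case/allpairsP => -[B i] [BT _ ->].
have kF C i : C \in T -> k \notin facet_opp C i.
  case/properT => _ ltC; rewrite !in_fsetE negb_and; apply/orP; right.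
  by apply/verticesP => -[j kE]; have := ltC j; rewrite -kE ltnn.
rewrite map_cat cat_uniq uniqT /= -map_comp; apply/andP; split.
  apply/hasPn => F /mapP[p]; rewrite mem_filter => /andP[_ /inL pT] ->.
  have [injC _] := properT _ pT; rewrite /= vertices_replace //.
  apply/negP => /mapP[B /properT[_ ltB] E].
  have /verticesP[j kE] : k \in vertices B by rewrite -E !in_fsetE eqxx.
  by have := ltB j; rewrite -kE ltnn.
rewrite map_inj_in_uniq.
  rewrite filter_uniq // allpairs_uniq ?enum_uniq ?(map_uniq uniqT) //.
  by move=> [? ?] [? ?] _ _.
move=> [C1 i1] [C2 i2]; rewrite !mem_filter.
case/andP => Q1 /inL /= C1T /andP[Q2 /inL /= C2T].
have [inj1 _] := properT _ C1T; have [inj2 _] := properT _ C2T.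
rewrite !vertices_replace // => E.
have eqF : facet_opp C1 i1 = facet_opp C2 i2.
  by rewrite -(fsetU1K (kF C1 i1 C1T)) E fsetU1K ?kF.
have eqC : C1 = C2.
  apply: (count1_inj (bQ _ Q1)) => //=; first exact: fsubsetDl.
  by rewrite eqF fsubsetDl.
by move: eqF; rewrite eqC => /(facet_opp_inj inj2) ->.
Qed.

Lemma ncells_proper k T : proper_cells k T -> ncells T = size T.
Proof.
case=> _ _ uniqT; rewrite -(size_map (@vertices d)) -(undup_id uniqT) -card_fseq.
congr (size (enum_fset _)); apply/fsetP => F; rewrite in_fsetE.
by apply/imfsetP/mapP => -[C CT ->]; exists C.
Qed.

End Cells.

(** * Exactness of the dynamic updates *)

Section DynamicDeterminants.
Variables (R : realFieldType) (d : nat) (A : {fset 'cV[R]_d}).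
Implicit Types (C : cell d) (T : seq (cell d)).

Definition cell_mx C : 'M[R]_(d + 1) := orientation_mx (fun j => point A (C j)).

Definition cell_datum C : cell_data R d :=
  CellData C (\det (cell_mx C)) (\adj (cell_mx C)).

Lemma cells_datum T : cells (map cell_datum T) = T.
Proof. by rewrite /cells -map_comp map_id_in. Qed.

Lemma attach_datum k C i :
  \det (cell_mx C) != 0 -> \det (cell_mx (replace_vertex k C i)) != 0 ->
  attach A k (cell_datum C) i = cell_datum (replace_vertex k C i).
Proof.
move=> D0 D'0; rewrite /attach /=.
have -> : homog (point A k) - homog (point A (C i)) =
    col i (cell_mx (replace_vertex k C i)) - col i (cell_mx C).
  by apply/matrixP => a b; rewrite [b]ord1 !mxE ffunE eqxx.
have eqC a j : j != i -> cell_mx (replace_vertex k C i) a j = cell_mx C a j.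
  by move=> /negPf ji; rewrite !mxE ffunE ji.
by rewrite dyn_detE // dyn_adjE.
Qed.

Lemma mem_point k : (k < #|` A|)%N -> point A k \in A.
Proof. by move=> kA; rewrite -(mem_sort (@lex_le R d)) mem_nth ?size_sort. Qed.

Hypothesis gpA : general_position A.

(** A kernel vector would be an affine dependence: the last row says that its coefficients sum to
    zero, the other rows that the combination of the points vanishes. *)
Lemma det_cell_mx_neq0 C :
  injective C -> (forall j, C j < #|` A|)%N -> \det (cell_mx C) != 0.
Proof.
move=> injC ltC; rewrite -det_tr; apply/det0P => -[v /negP v0 vM]; apply: v0.
have vM0 a : \sum_j v 0 j * homog (point A (C j)) a 0 = 0.
  have /matrixP/(_ 0 a) := vM; rewrite !mxE => vMa; apply: etrans vMa.
  by apply: eq_bigr => j _; rewrite !mxE.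
apply/eqP/rowP => j; rewrite mxE; move: j.
apply: (gpA (p := fun j => point A (C j))).
- move=> j1 j2 /eqP; rewrite /point nth_uniq ?size_sort ?sort_uniq ?fset_uniq //.
  by move/eqP/injC.
- by move=> j; apply: mem_point.
- apply: etrans (vM0 (rshift d ord0)); apply: eq_bigr => j _.
  by rewrite col_mxEd mxE mulr1.
- apply/colP => a; rewrite summxE mxE; apply: etrans (vM0 (lshift 1 a)).
  by apply: eq_bigr => j _; rewrite col_mxEu mxE.
Qed.

(** Properness of the new list comes first; with general position it makes the determinants of old
    and new cells nonzero, so that [attach_datum] applies. *)
Lemma insert_point_datum k T : (k < #|` A|)%N -> proper_cells k T ->
  exists2 T', insert_point A (map cell_datum T) k = map cell_datum T'
            & proper_cells k.+1 T'.
Proof.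
(* [Q] uses the determinant produced by [attach], so it selects the same cells as the algorithm
   before the update is known to be exact. *)
move=> kA properT; set Q := fun p : cell d * 'I_(d + 1) =>
  boundary T (facet_opp p.1 p.2) &&
  (\det (cell_mx p.1) * cdet (attach A k (cell_datum p.1) p.2) < 0).
set T' := T ++ [seq replace_vertex k p.1 p.2 |
  p <- [seq (C, i) | C <- T, i <- enum 'I_(d + 1)] & Q p].
have properT' : proper_cells k.+1 T'.
  by apply: proper_cells_insert properT => p /andP[].
exists T' => //; rewrite /insert_point map_cat cells_datum; congr (_ ++ _).
rewrite allpairs_mapl -(map_allpairs (fun p => (cell_datum p.1, p.2)) pair).
rewrite filter_map -!map_comp.
apply/eq_in_map => p pQ; have [pT pT'] : p.1 \in T /\ replace_vertex k p.1 p.2 \in T'.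
  split; last by rewrite mem_cat (map_f (fun p => replace_vertex k p.1 p.2)) ?orbT.
  by move: pQ; rewrite mem_filter => /andP[_ /allpairsP[[B i] [BT _ ->]]].
have [[_ prop _] [_ prop' _]] := (properT, properT').
have [[injC ltC] [injC' ltC']] := (prop _ pT, prop' _ pT').
by apply: attach_datum; apply: det_cell_mx_neq0 => // j;
  [apply: ltn_trans kA | apply: leq_trans kA].
Qed.

End DynamicDeterminants.

Lemma beneath_beyond_datum (R : realFieldType) (d : nat) (A : {fset 'cV[R]_d}) :
  general_position A -> (d + 1 <= #|` A|)%N ->
  exists2 T, beneath_beyond A = map (cell_datum A) T
           & proper_cells #|` A| T.
Proof.
move=> gpA dA; pose C0 : cell d := [ffun j : 'I_(d + 1) => val j].
have -> : beneath_beyond A = foldl (insert_point A) (map (cell_datum A) [:: C0])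
    (iota (d + 1) (#|` A| - (d + 1))).
  rewrite /beneath_beyond /initial_cell /= /cell_datum.
  have <- : cell_mx A C0 = orientation_mx (fun j : 'I_(d + 1) => point A j).
    by apply/matrixP => a b; rewrite !mxE ffunE.
  by [].
have insert_all p T k : (k + p = #|` A|)%N -> proper_cells k T ->
    exists2 T', foldl (insert_point A) (map (cell_datum A) T) (iota k p) =
                map (cell_datum A) T'
              & proper_cells #|` A| T'.
  elim: p T k => [|p IHp] T k /= kp properT; first by exists T; rewrite -?kp ?addn0.
  have kA : (k < #|` A|)%N by rewrite -kp addnS ltnS leq_addr.
  have [T' -> properT'] := insert_point_datum gpA kA properT.
  by apply: IHp => //; rewrite addSnnS.
apply: insert_all; first by rewrite subnKC.
split=> // C; rewrite inE => /eqP ->.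
by split=> [j1 j2|j]; rewrite !ffunE; [apply: val_inj | apply: ltn_ord].
Qed.

(** * Memory layout of the stored numbers *)

Lemma nth_flatten_const (T I : Type) (x0 : T) (y0 : I) (f : I -> seq T) m s i j :
  (forall y, size (f y) = m) -> (i < size s)%N -> (j < m)%N ->
  nth x0 (flatten [seq f y | y <- s]) (i * m + j) = nth x0 (f (nth y0 s i)) j.
Proof.
move=> szf + jm; elim: s i => [|y s IHs] [|i] //= si.
  by rewrite nth_cat szf jm.
by rewrite nth_cat szf mulSn -addnA ltnNge leq_addr addKn IHs.
Qed.

Lemma size_flatten_const (T I : Type) (f : I -> seq T) m s :
  (forall y, size (f y) = m) -> size (flatten [seq f y | y <- s]) = (size s * m)%N.
Proof. by move=> szf; elim: s => //= y s IHs; rewrite size_cat szf IHs. Qed.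

Definition block_size (d : nat) : nat := ((d + 1) * (d + 1)).+1.

(** The successor skips the determinant at the head of each block. *)
Definition adj_addr (d k i j : nat) : nat := k * block_size d + (i * (d + 1) + j).+1.

Lemma adj_addr_lt d k n (i : 'I_(d + 1)) j :
  (k < n)%N -> (j < d + 1)%N -> (adj_addr d k i j < n * block_size d)%N.
Proof.
move=> kn jd; rewrite (@leq_trans (k.+1 * block_size d)) ?leq_mul //.
rewrite /adj_addr mulSn [ltnRHS]addnC ltn_add2l /block_size ltnS.
by have := ltn_ord i; nia.
Qed.

Section Stored.
Variables (R : realFieldType) (d : nat).
Implicit Type s : seq (cell_data R d).

Lemma size_block (C : cell_data R d) :
  size (cdet C :: [seq cadj C i j | i <- enum 'I_(d + 1), j <- enum 'I_(d + 1)]) =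
  block_size d.
Proof. by rewrite /= size_allpairs size_enum_ord. Qed.

Lemma size_stored s : size (stored s) = (size s * block_size d)%N.
Proof. exact: size_flatten_const size_block. Qed.

Lemma nth_stored_adj C0 s k (i j : 'I_(d + 1)) : (k < size s)%N ->
  (stored s)`_(adj_addr d k i j) = cadj (nth C0 s k) i j.
Proof.
move=> ks; rewrite /stored (nth_flatten_const _ C0 size_block) //=; last first.
  by rewrite /block_size ltnS; case: i j => i /= ? [j /= ?]; nia.
rewrite (nth_flatten_const (m := (d + 1)%N) _ i) ?size_enum_ord //; last first.
  by move=> y; rewrite size_map size_enum_ord.
by rewrite (nth_map j) ?size_enum_ord // !nth_ord_enum.
Qed.

Lemma stored_bounded (P : R -> Prop) (A : {fset 'cV[R]_d}) (T : seq (cell d)) :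
  (forall C, C \in T -> P (\det (cell_mx A C))) ->
  (forall C i j, C \in T -> P (\adj (cell_mx A C) i j)) ->
  forall x, x \in stored (map (cell_datum A) T) -> P x.
Proof.
move=> Pdet Padj x; rewrite /stored -map_comp.
case/flatten_mapP => C CT; rewrite inE => /orP[/eqP -> | /allpairsP]; first exact: Pdet.
by case=> -[i j] [_ _ ->]; apply: Padj.
Qed.

End Stored.

(** * Reduction of an orientation test to a row of a stored adjugate *)

Section OrientationTest.
Variable d : nat.

(** [tau] sends each column of the cell to the position of the same vertex in [g], and column [i] to
    that of the query point. *)
Definition matches (C : cell d) (i : 'I_(d + 1)) (tau : {perm 'I_(d + 1)})
    (g : {ffun 'I_(d + 1) -> option nat}) : bool :=
  [forall j, g (tau j) == if j == i then None else Some (C j)].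

(** The prescribed entries are pairwise distinct and all occur in [g]; choosing a position for each
    gives an injection of a finite set into itself, hence a permutation. *)
Lemma matches_exists (C : cell d) i g :
  injective C -> orders (facet_opp C i) g -> exists tau, matches C i tau g.
Proof.
move=> injC og; pose h j := if j == i then None else Some (C j).
have injh : injective h.
  move=> j1 j2; rewrite /h; case: eqVneq => [->|_]; case: eqVneq => [->|_] //.
  by case=> /injC.
have gh j : exists j', g j' == h j.
  have : h j \in [fset g j | j in 'I_(d + 1)]%fset.
    rewrite og !in_fsetE /h; case: (eqVneq j i) => //= ji.
    apply/imfsetP; exists (C j) => //=.
    by rewrite !in_fsetE (inj_eq injC) ji; apply/verticesP; exists j.
  by case/imfsetP => j' _ ->; exists j'.
pose f j := xchoose (gh j).
have gf j : g (f j) = h j by apply/eqP/(xchooseP (gh j)).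
have injf : injective f by move=> j1 j2 E; apply: injh; rewrite -!gf E.
by exists (perm injf); apply/forallP => j; rewrite permE gf.
Qed.

(** The search sees only [T] and [g], never coordinates. The parity of [tau] selects addition or
    subtraction, and the initial term is the adjugate entry in column [d], which meets the
    homogeneous coordinate 1. *)
Definition orientation_prog (T : seq (cell d))
    (g : {ffun 'I_(d + 1) -> option nat}) : seq instr :=
  let m := (size T * block_size d)%N in
  if [pick p : 'I_(size T) * 'I_(d + 1) * {perm 'I_(d + 1)} |
      matches (nth [ffun=> 0%N] T p.1.1) p.1.2 p.2 g] is Some p
  then let: (k, i, tau) := p in
       sdot_prog tau (m + d) (adj_addr d k i d) (adj_addr d k i) (addn m) d
  else [::].

(** Permuting the columns by [tau] costs its sign and gives a matrix that agrees with [cell_mx A C]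
    off column [i], where it holds the query point. *)
Lemma det_matches (R : realFieldType) (A : {fset 'cV[R]_d}) C i tau g q :
  matches C i tau g ->
  \det (orientation_mx (fun j => if g j is Some v then point A v else q)) =
  (-1) ^+ tau * (\adj (cell_mx A C) *m homog q) i 0.
Proof.
move/forallP => gC; set P := fun j => _; set M := orientation_mx P.
have -> : \det M = (-1) ^+ tau * \det (col_perm tau M).
  rewrite col_permE det_mulmx det_perm odd_permV mulrCA -expr2 sqrr_sign.
  by rewrite mulr1.
congr (_ * _); rewrite (@det_eq_off_col _ _ (cell_mx A C) _ i).
  by congr ((_ *m _) _ _); apply/colP => a; rewrite !mxE /P (eqP (gC i)) eqxx.
by move=> a j /negPf ji; rewrite !mxE /P (eqP (gC j)) ji.
Qed.

Lemma adj_mul_homog (R : realFieldType) (B : 'M[R]_(d + 1)) i (q : 'cV[R]_d) :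
  (B *m homog q) i 0 =
  B i (rshift d ord0) + \sum_(j < d) B i (lshift 1 j) * q j 0.
Proof.
rewrite mxE big_split_ord /= big_ord1 addrC /homog col_mxEd mxE mulr1.
by congr (_ + _); apply: eq_bigr => j _; rewrite col_mxEu.
Qed.

Lemma size_coords (R : realFieldType) (q : 'cV[R]_d) : size (coords q) = d.
Proof. by rewrite size_map size_enum_ord. Qed.

Lemma nth_coords (R : realFieldType) (q : 'cV[R]_d) (j : 'I_d) : (coords q)`_j = q j 0.
Proof. by rewrite (nth_map j) ?size_enum_ord // nth_ord_enum. Qed.

(** [pick] may return another matching triple than the given one, so the triple is quantified anew;
    it precedes [q], since one program serves all query points. *)
Lemma exec_orientation_prog (R : realFieldType) (A : {fset 'cV[R]_d})
    (T : seq (cell d)) g :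
  (exists C i tau, C \in T /\ matches C i tau g) ->
  exists (C : cell d) (i : 'I_(d + 1)) (tau : {perm 'I_(d + 1)}),
  [/\ C \in T, matches C i tau g, size (orientation_prog T g) = d.*2.+1 &
   forall q : 'cV[R]_d, exists2 p : nat -> R,
     forall j : 'I_d, p j = \adj (cell_mx A C) i (lshift 1 j) * q j 0 &
     exec (stored (map (cell_datum A) T) ++ coords q) (orientation_prog T g) =
     (stored (map (cell_datum A) T) ++ coords q) ++
       sdot_trace tau (\adj (cell_mx A C) i (rshift d ord0)) p d].
Proof.
case=> C [i [tau [CT Cg]]]; rewrite /orientation_prog.
case: pickP => [[[k {}i] {}tau] /= {}Cg | none]; last first.
  have kT : (index C T < size T)%N by rewrite index_mem.
  by have := none (Ordinal kT, i, tau); rewrite /= nth_index ?Cg.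
exists (nth [ffun=> 0%N] T k), i, tau; split=> //; first exact: mem_nth.
  exact: size_sdot_prog.
move=> q; set st := stored _; set mem := st ++ _.
have szst : size st = (size T * block_size d)%N by rewrite size_stored size_map.
have szmem : size mem = (size T * block_size d + d)%N.
  by rewrite size_cat szst size_coords.
have memq j : mem`_(size T * block_size d + j) = (coords q)`_j.
  by rewrite nth_cat szst ltnNge leq_addr addKn.
have memadj (j : 'I_(d + 1)) : mem`_(adj_addr d k i j) =
    \adj (cell_mx A (nth [ffun=> 0%N] T k)) i j.
  rewrite nth_cat szst adj_addr_lt //.
  rewrite /st (nth_stored_adj (cell_datum A [ffun=> 0%N])) ?size_map //.
  by rewrite (nth_map [ffun=> 0%N]).
have addr_lt j : (j <= d)%N -> (adj_addr d k i j < size mem)%N.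
  move=> jd; rewrite szmem; apply: leq_trans (leq_addr _ _).
  by rewrite adj_addr_lt // addn1.
exists (fun j => mem`_(adj_addr d k i j) * mem`_(size T * block_size d + j)).
  by move=> j; rewrite memq nth_coords -memadj.
rewrite -memadj /= addn0 -szmem exec_sdot //; first exact: addr_lt.
  by move=> j /ltnW /addr_lt.
by move=> j jd; rewrite szmem ltn_add2l.
Qed.

End OrientationTest.

(** * Numerical bounds and final assembly *)

Lemma fact_exp_leq d tau m :
  (0 < d)%N -> (d <= tau)%N -> (m <= d.+1)%N ->
  (m`! * (2 ^ tau) ^ m <= 2 ^ (3 * (d * tau)))%N.
Proof.
move=> d0 dtau md.
(* One [d * tau] in the exponent covers the factorial, since [d <= tau]; two cover the power, since
   [d + 1 <= 2 * d]. *)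
apply: (@leq_trans (2 ^ (d * tau) * 2 ^ (2 * (d * tau)))).
  apply: leq_mul.
    apply: leq_trans (leq_fact md) (leq_trans (fact_leq_exp2 d) _).
    by rewrite leq_pexp2l // leq_mul.
  by rewrite -expnM leq_pexp2l //; nia.
by rewrite -expnD leq_pexp2l //; lia.
Qed.

Lemma cell_mx_bounded (R : realFieldType) (d tau : nat) (A : {fset 'cV[R]_d})
    (C : cell d) :
  (forall x, x \in A -> forall i, bitsize_le tau (x i 0)) ->
  (forall j, C j < #|` A|)%N ->
  forall k j, int_bounded (2 ^ tau) (cell_mx A C k j).
Proof.
move=> bA ltC k j; rewrite mxE /homog mxE; case: splitP => a _.
  by apply: bitsize_int_bounded; apply: bA; apply: mem_point.
rewrite mxE; apply: leq_int_bounded (int_bounded1 R); exact: expn_gt0.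
Qed.

(* K makes "large compared with d" precise and c is the constant of the three
   O-bounds.  The program of a test may depend on the combinatorial structure
   of the triangulation and on the ordered facet, but not on the coordinates. *)
Theorem corollary2 :
  exists (K c : nat)
    (prog : forall d : nat, seq (cell d) -> {ffun 'I_(d + 1) -> option nat} ->
            seq instr),
  forall (R : realType) (d n tau : nat) (A : {fset 'cV[R]_d}),
    (0 < d)%N -> (K * d <= n)%N -> (K * d <= tau)%N ->
    #|` A|%fset = n ->
    general_position A ->
    (forall x, x \in A -> forall i, bitsize_le tau (x i 0)) ->
    let s := beneath_beyond A in
    let T := cells s in
    let t := ncells T in
    [/\ (size (stored s) <= c * (d ^ 2 * t))%N,
        forall x, x \in stored s -> bitsize_le (c * (d * tau)) x
      & forall (F : {fset nat}) (g : {ffun 'I_(d + 1) -> option nat}),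
          is_facet T F -> orders F g ->
          (size (prog d T g) <= c * d)%N /\
          forall q : 'cV[R]_d,
            let mem := exec (stored s ++ coords q) (prog d T g) in
            [/\ Num.sg (output mem) = orientation_test A g q,
                (size mem <= c * (d ^ 2 * t))%N
              & (forall i, bitsize_le tau (q i 0)) ->
                forall x, x \in mem -> bitsize_le (c * (d * tau)) x]].
Proof.
(* [K = 2] gives [d <= tau] and [d + 1 <= n], so the initial cell exists. [c = 9] comes from the
   memory: a block takes at most [5 * d ^ 2] numbers, the query and the program together
   [3 * d + 1 <= 4 * d ^ 2]. *)
exists 2, 9, orientation_prog => R d n tau A d0 dn dtau cardA gpA bA.
have dA : (d + 1 <= #|` A|)%N by rewrite cardA; lia.
have [T -> properT] := beneath_beyond_datum gpA dA.
move=> s; rewrite /= cells_datum (ncells_proper properT).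
have [T0 cellT _] := properT.
have t0 : (0 < size T)%N by case: (T) T0.
have szs : size (stored s) = (size T * block_size d)%N.
  by rewrite size_stored size_map.
have block_le : (block_size d <= 5 * d ^ 2)%N by rewrite /block_size; nia.
have M0 C : C \in T -> forall k j, int_bounded (2 ^ tau) (cell_mx A C k j).
  by case/cellT => _ ltC; apply: cell_mx_bounded.
have bAdj C i j : C \in T -> int_bounded (2 ^ (3 * (d * tau))) (\adj (cell_mx A C) i j).
  move=> CT; apply: leq_int_bounded (int_bounded_adj (M0 C CT) i j).
  by apply: fact_exp_leq => //; lia.
have bs x : x \in stored s -> bitsize_le (9 * (d * tau)) x.
  move=> xs; apply: (@leq_bitsize_le _ (3 * (d * tau)).+1); first by nia.
  apply: int_bounded_bitsize; move: x xs; apply: stored_bounded => // C CT.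
  apply: leq_int_bounded (int_bounded_det (M0 C CT)).
  by apply: fact_exp_leq => //; lia.
split=> // [|F g [C CT [i FE]] og]; first by rewrite szs; nia.
have [injC _] := cellT _ CT.
have [tau0 Cg0] : exists tau, matches C i tau g.
  by apply: matches_exists => //; rewrite -FE.
have := @exec_orientation_prog d R A T g.
case; first by exists C, i, tau0.
move=> {tau0 Cg0 FE og injC i C CT} [C [i [sigma [CT Cg -> run]]]].
split; first by lia.
move=> q /=; have [p pE ->] := run q; set u := \adj _ _ _; split.
(* The trace is nonempty, so the output is its last entry, the signed dot product. *)
- rewrite /output last_cat; case: sdot_trace (size_sdot_trace sigma u p d)
    (last_sdot_trace sigma u p d) => // v tr _ /= ->.
  rewrite /orientation_test /orientation (det_matches _ _ Cg) adj_mul_homog /sdot.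
  by congr (Num.sg (_ * (_ + _))); apply: eq_bigr.
- rewrite !size_cat size_sdot_trace size_coords szs.
  by have : (size T * block_size d <= 5 * (d ^ 2 * size T))%N; nia.
move=> bq x; rewrite !mem_cat -orbA => /or3P[/bs // | /mapP[j _ ->] |].
  by apply: leq_bitsize_le (bq j); nia.
(* Products are at most [2 ^ (3 * d * tau) * 2 ^ tau <= 2 ^ (4 * d * tau)]; the [d + 1 <= 2 ^ d]
   terms of the sum add at most [d * tau] to the exponent, and the conversion to bit-size adds one
   bit. *)
move=> xtr; apply: (@leq_bitsize_le _ (5 * (d * tau)).+1); first by nia.
apply: int_bounded_bitsize.
apply: leq_int_bounded (int_bounded_sdot_trace (M := 2 ^ (4 * (d * tau))) _ _ xtr).
- rewrite (leq_trans (leq_mul (ltn_expl d (isT : 1 < 2)%N) (leqnn _))) //.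
  by rewrite -expnD leq_pexp2l //; nia.
- by apply: leq_int_bounded (bAdj _ _ _ CT); rewrite leq_pexp2l //; lia.
- move=> j jd; rewrite (pE (Ordinal jd)).
  apply: leq_int_bounded (int_boundedM (bAdj _ _ _ CT) (bitsize_int_bounded (bq _))).
  by rewrite -expnD leq_pexp2l //; nia.
Qed.
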